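(* Let $\alpha > 1$ be a constant integer. There is a polynomial-time $O\!\left(n^{1-\frac{1}{\alpha}}(\log n)^{\frac{1}{\alpha}}\right)$-approximation algorithm for the 1-DR-$\alpha$ problem, where $n$ is the number of vertices of the input graph.
   Context: For a graph $G=(V,E)$ and $S\subseteq V$, $G[S]$ is the subgraph induced by $S$. For vertices $u,v$, $m_G(u,v)$ is the number of internal vertices on a shortest $u$–$v$ path in $G$ (so $m_G(u,v)=0$ if $u,v$ are adjacent, and $m_G(u,v)=1$ if they are non-adjacent but have a common neighbor); it is $\infty$ if no path exists. For $D\subseteq V$, $m^D_G(u,v)=m_{G[D\cup\{u,v\}]}(u,v)$. Two vertices $u,v$ form a target couple $[u,v]$ if $m_G(u,v)=1$. A set $D$ covers a target couple $[u,v]$ if $m^D_G(u,v)\le\alpha$. A set $D$ is a dominating set if every vertex of $V\setminus D$ is adjacent to a vertex of $D$. The 1-DR-$\alpha$ problem ($\alpha$ a positive integer): given a connected graph $G$, find a minimum-cardinality dominating set $D$ of $G$ that covers every target couple of $G$. An $r$-approximation algorithm outputs a feasible solution of size at most $r$ times the optimum. *)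

(* Defs.v *)
From HB Require Import structures.
From mathcomp Require Import all_boot all_order all_algebra.
From mathcomp Require Import all_classical all_reals all_analysis.

Set Implicit Arguments.
Unset Strict Implicit.
Unset Printing Implicit Defensive.

Import Order.TTheory GRing.Theory Num.Theory.
Import numFieldNormedType.Exports.

Local Open Scope nat_scope.

(** * Graphs: the edge relation of a graph with vertex set V is e : rel V *)

Section Graphs.

Variable V : finType.
Implicit Types (e : rel V) (u v : V) (S D : {set V}) (p : seq V).

Definition simple_graph e : Prop := symmetric e /\ irreflexive e.

Definition connected_graph e : Prop :=
  0 < #|V| /\ forall u v, connect e u v.

(* G[S].  Vertices outside S stay in the type V, but are isolated, so they lie
   on no path joining two vertices of S. *)
Definition induced e S : rel V :=
  [rel x y | [&& x \in S, y \in S & e x y]].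

(* u :: p is the vertex sequence of a u-v path; its length is size p, and it
   has (size p).-1 internal vertices. *)
Definition is_path e u v p : bool :=
  [&& path e u p, uniq (u :: p) & last u p == v].

(* Length of a shortest u-v path; the value is #|V| when there is no path, as
   every path has at most #|V| vertices, hence length < #|V|. *)
Definition path_dist e u v : nat :=
  find (fun k => [exists p : k.-tuple V, is_path e u v p]) (iota 0 #|V|).

(* m_G(u,v), with None for infinity. *)
Definition mG e u v : option nat :=
  if path_dist e u v < #|V| then Some (path_dist e u v).-1 else None.

Definition le_opt (x : option nat) (a : nat) : bool :=
  if x is Some k then k <= a else false.

Definition mGD e D u v : option nat := mG (induced e (D :|: [set u; v])) u v.

Definition target_couple e u v : Prop := mG e u v = Some 1.

Definition covers (alpha : nat) e D u v : Prop := le_opt (mGD e D u v) alpha.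

Definition dominating e D : Prop :=
  forall x, x \notin D -> exists2 y, y \in D & e x y.

Definition feasible (alpha : nat) e D : Prop :=
  dominating e D /\ forall u v, target_couple e u v -> covers alpha e D u v.

Definition optimal (alpha : nat) e D : Prop :=
  feasible alpha e D /\ forall D', feasible alpha e D' -> #|D| <= #|D'|.

Lemma path_distP e u v k :
  path_dist e u v = k -> k < #|V| ->
  (exists2 p, is_path e u v p & size p = k) /\
  (forall p, is_path e u v p -> k <= size p).
Proof.
rewrite /path_dist => Hk ltkV.
have hs : has (fun k => [exists p : k.-tuple V, is_path e u v p]) (iota 0 #|V|).
  by rewrite has_find size_iota Hk.
split.
  have := nth_find 0 hs; rewrite Hk nth_iota // add0n.
  by case/existsP => p Hp; exists p => //; rewrite size_tuple.
move=> p Hp; case: leqP => // ltpk.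
have := @before_find _ 0 (fun k => [exists p : k.-tuple V, is_path e u v p])
  (iota 0 #|V|) (size p).
rewrite Hk => /(_ ltpk); rewrite nth_iota ?add0n; last exact: ltn_trans ltkV.
by move/existsP; case; exists (in_tuple p).
Qed.

Lemma mG_NoneP e u v : mG e u v = None <-> (forall p, ~~ is_path e u v p).
Proof.
rewrite /mG; set d := path_dist e u v; split.
  case: ifP => // /negbT; rewrite -leqNgt => Vd _ p; apply/negP => Hp.
  have szp : size p < #|V|.
    case/and3P: (Hp) => _ Up _.
    by have := card_uniqP Up => /= <-; rewrite max_card.
  have := @before_find _ 0 (fun k => [exists p : k.-tuple V, is_path e u v p])
    (iota 0 #|V|) (size p) (leq_trans szp Vd).
  rewrite nth_iota ?add0n // => /existsP; case.
  by exists (in_tuple p).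
move=> noP; case: ifP => // ltd.
by have [[p Hp _] _] := path_distP (erefl d) ltd; rewrite (negbTE (noP p)) in Hp.
Qed.

End Graphs.

(** * Computation model: unit-cost random-access machine *)

(* Registers and memory cells hold natural numbers.  The only arithmetic is
   addition and (truncated) subtraction, so that a run of t unit-cost steps only
   produces numbers of bit length O(t + input size): polynomial time here
   agrees with polynomial time on Turing machines (multiplication at unit cost
   would break this). *)
Inductive prog : Type :=
| Skip
| Const of nat & nat              (* x := k *)
| Add of nat & nat & nat          (* x := y + z *)
| Sub of nat & nat & nat          (* x := y - z *)
| Read of nat & nat               (* x := M[y] *)
| Write of nat & nat              (* M[x] := y *)
| Seq of prog & prog
| If of nat & prog & prog         (* if x != 0 then .. else .. *)
| While of nat & prog.            (* while x != 0 do .. *)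

Record state : Type := State { reg : nat -> nat; mem : nat -> nat }.

Definition upd (f : nat -> nat) (a k : nat) : nat -> nat :=
  fun b => if b == a then k else f b.

Definition set_reg (s : state) (x k : nat) : state :=
  State (upd (reg s) x k) (mem s).

Definition set_mem (s : state) (a k : nat) : state :=
  State (reg s) (upd (mem s) a k).

(* exec c s t s': started in state s, program c halts in state s' after t steps
   (basic instructions and tests cost one step each). *)
Inductive exec : prog -> state -> nat -> state -> Prop :=
| ExecSkip s : exec Skip s 1 s
| ExecConst s x k : exec (Const x k) s 1 (set_reg s x k)
| ExecAdd s x y z : exec (Add x y z) s 1 (set_reg s x (reg s y + reg s z))
| ExecSub s x y z : exec (Sub x y z) s 1 (set_reg s x (reg s y - reg s z))
| ExecRead s x y : exec (Read x y) s 1 (set_reg s x (mem s (reg s y)))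
| ExecWrite s x y : exec (Write x y) s 1 (set_mem s (reg s x) (reg s y))
| ExecSeq c1 c2 s t1 s1 t2 s2 :
    exec c1 s t1 s1 -> exec c2 s1 t2 s2 -> exec (Seq c1 c2) s (t1 + t2) s2
| ExecIfT x c1 c2 s t s' :
    reg s x != 0 -> exec c1 s t s' -> exec (If x c1 c2) s t.+1 s'
| ExecIfF x c1 c2 s t s' :
    reg s x = 0 -> exec c2 s t s' -> exec (If x c1 c2) s t.+1 s'
| ExecWhileF x c s : reg s x = 0 -> exec (While x c) s 1 s
| ExecWhileT x c s t1 s1 t2 s2 :
    reg s x != 0 -> exec c s t1 s1 -> exec (While x c) s1 t2 s2 ->
    exec (While x c) s (t1 + t2).+1 s2.

Lemma exec_det c s t1 s1 t2 s2 :
  exec c s t1 s1 -> exec c s t2 s2 -> t1 = t2 /\ s1 = s2.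
Proof.
move=> Hrun; move: t2 s2; induction Hrun => tf sf Hf; inversion Hf; subst => //;
  repeat match goal with
  | IH : forall t s, exec ?c ?a t s -> _, E : exec ?c ?a _ _ |- _ =>
      case: (IH _ _ E) => ? ?; subst; clear IH
  | nz : is_true (reg ?s ?x != 0), z : reg ?s ?x = 0 |- _ =>
      by rewrite z in nz
  end; by [].
Qed.

(** * Approximation algorithms *)

(* A graph on 'I_n is given as n in register 0 and its adjacency matrix, stored
   row by row in the cells 0, ..., n^2 - 1; everything else is 0. *)
Definition input_state n (e : rel 'I_n) : state :=
  State (fun x => if x == 0 then n else 0)
        (fun a => nat_of_bool
           [exists i : 'I_n, exists j : 'I_n, (a == i * n + j) && e i j]).

(* The output set is read off the cells n^2, ..., n^2 + n - 1 as an indicator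
   vector. *)
Definition output_set n (s : state) : {set 'I_n} :=
  [set i : 'I_n | mem s (n * n + i) != 0].

(* c is a polynomial-time r(n)-approximation algorithm for 1-DR-alpha.  The
   input has size Theta(n^2), so polynomial in n is polynomial in the input
   size.  The run is unique by exec_det. *)
Definition polytime_approx (R : realType) (alpha : nat) (r : nat -> R)
    (c : prog) : Prop :=
  exists P : {poly nat}, forall (n : nat) (e : rel 'I_n),
    simple_graph e -> connected_graph e ->
    exists t s,
      [/\ exec c (input_state e) t s,
          t <= P.[n]%R,
          feasible alpha e (output_set n s) &
          forall Dopt : {set 'I_n}, optimal alpha e Dopt ->
            (#|output_set n s|%:R <= r n * #|Dopt|%:R :> R)%R].

(* Main.v *)
Require Import Defs.
From HB Require Import structures.
From mathcomp Require Import all_boot all_order all_algebra.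
From mathcomp Require Import all_classical all_reals all_analysis.
From mathcomp Require Import zify ring lra.
Set Implicit Arguments.
Unset Strict Implicit.
Unset Printing Implicit Defensive.
Import Order.TTheory GRing.Theory Num.Theory.
Import numFieldNormedType.Exports.


(** Set cover over walks.  The elements to cover are the target couples and the
    diagonal pairs (u,u), which encode domination; the sets are indexed by the
    sequences of alpha vertices in which consecutive vertices are equal or
    adjacent, and such a walk covers (u,v) when its first vertex is u or a
    neighbour of u and its last vertex is v or a neighbour of v.  A set of
    vertices is feasible exactly when the walks inside it cover everything, so
    the at most |D|^alpha walks inside an optimal D form a cover.  Greedy set
    cover therefore selects at most OPT^alpha * H(n^2) walks and outputs at most
    min(n, O(OPT^alpha log n)) vertices, and the weighted geometric mean of the
    two bounds is O(n^(1-1/alpha) (log n)^(1/alpha)) * OPT.  Greedy is run with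
    a threshold K going down from n^2 to 1: one pass over all walks selects
    those that cover at least K uncovered pairs, and since the previous pass
    left no walk covering more than K, every selection is a greedy one. *)

Local Open Scope nat_scope.

(** * Greedy set cover *)

Section Harmonic.

Local Open Scope ring_scope.

Lemma div_le_series_harmonic (R : numFieldType) (a b : nat) : (b <= a)%N ->
  (a - b)%N%:R / a%:R <= series harmonic a - series harmonic b :> R.
Proof.
move=> le_ba; rewrite sub_series_geq //.
have -> : (a - b)%N%:R / a%:R = \sum_(b <= i < a) a%:R^-1 :> R.
  by rewrite sumr_const_nat mulr_natl.
apply: ler_sum_nat => i /andP[_ lt_ia]; rewrite /= lef_pV2 ?posrE ?ltr0n //.
  by rewrite ler_nat.
exact: leq_ltn_trans lt_ia.
Qed.

Lemma series_harmonic_le_ln (R : realType) (n : nat) :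
  (0 < n)%N -> series harmonic n <= 1 + ln n%:R :> R.
Proof.
elim: n => // -[|n] IH _.
  by rewrite seriesSr /series /= big_nil ln1 invr1 add0r addr0.
rewrite seriesSr /=; set x := n.+2%:R^-1.
suff : x <= ln n.+2%:R - ln n.+1%:R by have := IH isT; lra.
have n1E : n.+1%:R = n.+2%:R * (1 - x) :> R.
  by rewrite mulrBr mulr1 divff ?pnatr_eq0 // -[n.+2%:R]natr1 addrK.
have x_lt1 : x < 1 by rewrite invf_lt1 ?ltr0n // ltr1n.
rewrite n1E lnM ?posrE ?ltr0n ?subr_gt0 //.
by have : ln (1 - x) <= - x by [apply: le_ln1Dx; lra]; lra.
Qed.

End Harmonic.

Section GreedyCover.

Variables (I : Type) (T : finType) (S : I -> {set T}) (P : pred I) (X : {set T}).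
Implicit Types (i j : I) (s : seq I) (m K : nat).

Definition coverable m : Prop :=
  exists s, [/\ size s <= m, all P s & X \subset \bigcup_(i <- s) S i].

Definition uncovered s : {set T} := X :\: \bigcup_(i <- s) S i.

Definition gain s i : nat := #|S i :&: uncovered s|.

Fixpoint greedy s : Prop :=
  if s is i :: s' then
    [/\ greedy s', P i, 0 < gain s' i & forall j, P j -> gain s' j <= gain s' i]
  else True.

Lemma greedy_all s : greedy s -> all P s.
Proof. by elim: s => //= i s IH [/IH-> ->]. Qed.

Lemma uncovered_nil : uncovered [::] = X.
Proof. by rewrite /uncovered big_nil finset.setD0. Qed.

Lemma uncovered_cons s i : uncovered (i :: s) = uncovered s :\: S i.
Proof. by rewrite /uncovered big_cons finset.setDDl finset.setUC. Qed.

Lemma card_uncovered_cons s i : #|uncovered s| = gain s i + #|uncovered (i :: s)|.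
Proof. by rewrite uncovered_cons /gain finset.setIC cardsID. Qed.

Lemma gain_cons_le s i j : gain (i :: s) j <= gain s j.
Proof. by rewrite subset_leq_card // uncovered_cons finset.setIS // finset.subsetDl. Qed.

Lemma gain_cons_same s i : gain (i :: s) i = 0.
Proof.
by apply/eqP; rewrite cards_eq0 uncovered_cons finset.setIDA finset.setDIl finset.setDv
  finset.set0I.
Qed.

Lemma card_uncovered_le m K s :
  coverable m -> (forall i, P i -> gain s i <= K) -> #|uncovered s| <= m * K.
Proof.
move=> [cov [size_cov cov_P X_cov]] gain_le.
apply: (@leq_trans (size cov * K)); last by rewrite leq_mul2r size_cov orbT.
have -> : uncovered s = \bigcup_(i <- cov) S i :&: uncovered s.
  by rewrite (finset.setIidPr _) // (fintype.subset_trans _ X_cov) // finset.subsetDl.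
elim: cov cov_P {size_cov X_cov} => [|i cov IH] /=.
  by rewrite big_nil finset.set0I cards0.
case/andP=> Pi /IH le_cov; rewrite big_cons finset.setIUl mulSn.
by apply: leq_trans (leq_card_setU _ _) _; rewrite leq_add // gain_le.
Qed.

Lemma greedy_size (R : realFieldType) m s : coverable m -> greedy s ->
  ((size s)%:R + m%:R * series harmonic #|uncovered s| <=
   m%:R * series harmonic #|X| :> R)%R.
Proof.
move=> cov; elim: s => [|i s IH] /=; first by rewrite uncovered_nil add0r.
case=> /IH {}IH _ gain_gt0 gain_max; apply: le_trans IH.
have /= gain_ge := card_uncovered_le cov gain_max.
have cardE := card_uncovered_cons s i.
have uncov_gt0 : 0 < #|uncovered s| by rewrite cardE ltn_addr.
have le_uncov : #|uncovered (i :: s)| <= #|uncovered s| by rewrite cardE leq_addl.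
suff : (1 <= m%:R * (series harmonic #|uncovered s| -
    series harmonic #|uncovered (i :: s)|) :> R)%R by rewrite -natr1 mulrBr; lra.
apply: le_trans (ler_wpM2l (ler0n _ m) (div_le_series_harmonic R le_uncov)).
by rewrite cardE addnK -cardE mulrA ler_pdivlMr ?ltr0n // mul1r -natrM ler_nat.
Qed.

Definition greedy_below K s : Prop := greedy s /\ forall i, P i -> gain s i <= K.

Definition add_above K s i : seq I := if P i && (K <= gain s i) then i :: s else s.

Lemma greedy_below_nil K : #|X| <= K -> greedy_below K [::].
Proof.
move=> le_XK; split=> // i _; apply: leq_trans le_XK.
by rewrite /gain uncovered_nil subset_leq_card // finset.subsetIr.
Qed.

Lemma greedy_below_add K s i :
  0 < K -> greedy_below K s -> greedy_below K (add_above K s i).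
Proof.
move=> K_gt0 [greedy_s gain_le]; rewrite /add_above; case: ifP => // /andP[Pi le_gain].
split=> [|j /gain_le] /=; last by apply: leq_trans; exact: gain_cons_le.
by split=> // [|j /gain_le/leq_trans->//]; exact: leq_trans le_gain.
Qed.

Lemma gain_add_above_le K s i j : gain (add_above K s i) j <= gain s j.
Proof. by rewrite /add_above; case: ifP => // _; exact: gain_cons_le. Qed.

Lemma gain_add_above_same K s i : 0 < K -> P i -> gain (add_above K s i) i < K.
Proof.
move=> K_gt0 Pi; rewrite /add_above Pi /=.
by case: (leqP K (gain s i)) => // _; rewrite gain_cons_same.
Qed.

Lemma greedy_below_pred K s :
  (forall i, P i -> gain s i < K) -> greedy_below K s -> greedy_below K.-1 s.
Proof.
by move=> gain_lt [greedy_s _]; split=> // i /gain_lt; case: (K).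
Qed.

Lemma greedy_below0_uncovered s :
  (forall x, x \in X -> exists2 i, P i & x \in S i) -> greedy_below 0 s ->
  uncovered s = finset.set0.
Proof.
move=> X_cov [_ gain0]; apply/setP => x; rewrite finset.in_set0; apply/negP => x_uncov.
have [i Pi x_i] := X_cov x (fintype.subsetP (finset.subsetDl _ _) _ x_uncov).
have := gain0 i Pi; rewrite leqn0 cards_eq0 => /eqP/setP/(_ x).
by rewrite finset.in_setI x_i x_uncov finset.in_set0.
Qed.

End GreedyCover.

Lemma mem_bigcup_seq (I : eqType) (T : finType) (S : I -> {set T}) (s : seq I) x :
  x \in \bigcup_(i <- s) S i -> exists2 i, i \in s & x \in S i.
Proof.
elim: s => [|i s IH]; first by rewrite big_nil inE.
rewrite big_cons inE => /orP[x_i|/IH[j j_s x_j]]; first by exists i; rewrite ?mem_head.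
by exists j; rewrite // inE j_s orbT.
Qed.

(** * Walks and feasible sets *)

Section Walks.

Variable V : finType.
Implicit Types (e : rel V) (u v x y : V) (p q w : seq V) (D S : {set V}) (k : nat).

Definition looped e : rel V := [rel x y | (x == y) || e x y].

Definition walk e k : pred (seq V) :=
  [pred w | (size w == k.+1) && sorted (looped e) w].

Definition reach e w : {set V * V} :=
  if w is x :: q then [set p | looped e p.1 x && looped e (last x q) p.2] else finset.set0.

Definition edge_set e : {set V * V} := [set p | e p.1 p.2].

Definition diagonal : {set V * V} := [set p | p.1 == p.2].

Definition open_wedges e : {set V * V} :=
  [set p | [exists y, [&& e p.1 y, e y p.2 & ~~ e p.1 p.2]]].

Definition required e : {set V * V} := diagonal :|: open_wedges e.

Lemma loopedxx e x : looped e x x.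
Proof. by rewrite /looped /= eqxx. Qed.

Lemma sub_looped e : subrel e (looped e).
Proof. by move=> x y; rewrite /looped /= => ->; rewrite orbT. Qed.

Lemma looped_sym e : symmetric e -> symmetric (looped e).
Proof. by move=> sym_e x y; rewrite /looped /= eq_sym sym_e. Qed.

Lemma edge_set_looped e : edge_set (looped e) = diagonal :|: edge_set e.
Proof. by apply/setP => p; rewrite !inE. Qed.

Lemma uniq_looped_path e x p : uniq (x :: p) -> path (looped e) x p -> path e x p.
Proof.
elim: p x => //= y p IH x; rewrite inE negb_or /= => /andP[/andP[/negbTE neq_xy _] uniq_p].
by rewrite {1}/looped /= neq_xy /= => /andP[-> /IH->].
Qed.

Lemma le_mGP e u v k :
  le_opt (mG e u v) k <-> exists2 p, is_path e u v p & size p <= k.+1.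
Proof.
split=> [|[p e_p size_p]].
  rewrite /mG; case: ifP => //= lt_dist le_k.
  have [[p e_p size_p] _] := path_distP erefl lt_dist.
  by exists p; rewrite // size_p; lia.
case mGE: (mG e u v) => [d|]; last by have /mG_NoneP/(_ p) := mGE; rewrite e_p.
move: mGE; rewrite /mG; case: ifP => // lt_dist [<-] /=.
by have [_ /(_ _ e_p)] := path_distP erefl lt_dist; lia.
Qed.

Lemma le_mG_looped e u p k :
  path (looped e) u p -> size p <= k.+1 -> le_opt (mG e u (last u p)) k.
Proof.
move=> e_p size_p; case/shortenP: e_p => p' e_p' uniq_p' sub_p'.
apply/le_mGP; exists p'; first by rewrite /is_path uniq_looped_path // uniq_p' eqxx.
by apply: leq_trans size_p; apply: uniq_leq_size sub_p'; case/andP: uniq_p'.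
Qed.

Lemma target_coupleP e u v :
  target_couple e u v <-> u != v /\ (u, v) \in required e.
Proof.
rewrite /target_couple !inE /=; split=> [mG1|[neq_uv]].
  have not_uv : ~~ looped e u v.
    apply/negP => uv; have := @le_mG_looped e u [:: v] 0.
    by rewrite /= mG1 uv => /(_ isT isT).
  have [neq_uv not_e_uv] := norP not_uv; split=> //; apply/orP; right; apply/existsP.
  have [|p /and3P[e_p _ /eqP last_p] size_p] := (le_mGP e u v 1).1; first by rewrite mG1.
  case: p => [|y [|z [|//]]] /= in e_p last_p size_p.
  - by rewrite last_p eqxx in neq_uv.
  - by rewrite -last_p (andP e_p).1 in not_e_uv.
  - by case/and3P: e_p => e_uy e_yz _; exists y; rewrite e_uy -last_p e_yz last_p.
rewrite (negbTE neq_uv) => /existsP[y /and3P[e_uy e_yv not_e_uv]].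
have le1 : le_opt (mG e u v) 1.
  by apply: (@le_mG_looped e u [:: y; v]); rewrite //= !sub_looped.
have not_le0 : ~~ le_opt (mG e u v) 0.
  apply/negP => /le_mGP[[|z [|//]] /and3P[e_p _ /eqP/= last_p]] _.
    by rewrite last_p eqxx in neq_uv.
  by move: e_p; rewrite /= last_p (negbTE not_e_uv).
by case: (mG e u v) le1 not_le0 => [[|[]]|].
Qed.

Lemma walk_pad e k x q : path (looped e) x q -> size q <= k ->
  exists w, [/\ walk e k w, {subset w <= x :: q} & reach e w = reach e (x :: q)].
Proof.
move=> e_q size_q; exists (x :: q ++ nseq (k - size q) (last x q)).
have last_pad y m : last y (nseq m y) = y by elim: m.
have path_pad y m : path (looped e) y (nseq m y) by elim: m => //= m ->; rewrite loopedxx.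
split; rewrite /= ?last_cat ?last_pad //.
  by rewrite /walk /= size_cat size_nseq subnKC // eqxx cat_path e_q path_pad.
move=> y; rewrite inE mem_cat mem_nseq => /or3P[/eqP->|y_q|/andP[_ /eqP->]].
- exact: mem_head.
- by rewrite inE y_q orbT.
- exact: mem_last.
Qed.

Lemma required_walk e k (p : V * V) :
  p \in required e -> exists2 w, walk e k w & p \in reach e w.
Proof.
case: p => u v; rewrite !inE /= => req.
have [y uy yv] : exists2 y, looped e u y & looped e y v.
  case/orP: req => [/eqP->|/existsP[y /and3P[e_uy e_yv _]]].
    by exists v; exact: loopedxx.
  by exists y; exact: sub_looped.
have [w [e_w _ reach_w]] := @walk_pad e k y [::] isT isT.
by exists w; rewrite // reach_w inE /= uy yv.
Qed.

Lemma walk_covers e k D w u v : walk e k w -> {subset w <= D} ->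
  (u, v) \in reach e w -> covers k.+1 e D u v.
Proof.
case: w => [//|x q] /andP[/eqP/= [size_q] e_q] q_D; rewrite inE /= => /andP[ux qv].
set S := D :|: [set u; v].
have S_path : all (mem S) (u :: x :: rcons q v).
  apply/allP => y; rewrite inE -rcons_cons mem_rcons inE => y_uqv; rewrite !inE.
  by case/or3P: y_uqv => [->|->|/q_D->]; rewrite ?orbT.
have sub_S : {in S &, subrel (looped e) (looped (Defs.induced e S))}.
  by move=> y z y_S z_S; rewrite /looped /Defs.induced /= y_S z_S.
have := @le_mG_looped (Defs.induced e S) u (x :: rcons q v) k.+1.
rewrite (sub_in_path sub_S S_path) /= ?size_rcons ?size_q ?last_rcons; first exact.
by rewrite rcons_path ux e_q.
Qed.

Lemma walk_dominates e k D x w : walk e k w -> {subset w <= D} ->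
  (x, x) \in reach e w -> x \notin D -> exists2 y, y \in D & e x y.
Proof.
case: w => [//|y q] _ /(_ y (mem_head _ _)) y_D.
rewrite inE /looped /= => /andP[/orP[/eqP->|e_xy] _]; first by rewrite y_D.
by exists y.
Qed.

Lemma feasible_diag_walk e k D x : symmetric e -> feasible k.+1 e D ->
  exists w, [/\ walk e k w, {subset w <= D} & (x, x) \in reach e w].
Proof.
move=> sym_e [dom _].
have [y y_D xy] : exists2 y, y \in D & looped e x y.
  have [x_D|/dom[y y_D e_xy]] := boolP (x \in D).
    by exists x; rewrite // loopedxx.
  by exists y; rewrite ?sub_looped.
have [w [e_w w_y reach_w]] := @walk_pad e k y [::] isT isT.
exists w; split; rewrite ?reach_w ?inE //=; last by rewrite xy looped_sym.
by move=> z /w_y; rewrite inE => /eqP->.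
Qed.

Lemma all_induced_path e S x p : path (Defs.induced e S) x p -> all (mem S) p.
Proof. by elim: p x => //= y p IH x /andP[/and3P[_ -> _] /IH]. Qed.

Lemma feasible_target_walk e k D u v : feasible k.+1 e D ->
  u != v -> (u, v) \in required e ->
  exists w, [/\ walk e k w, {subset w <= D} & (u, v) \in reach e w].
Proof.
move=> [_ cov] neq_uv req.
have not_e_uv : ~~ e u v.
  by move: req; rewrite !inE /= (negbTE neq_uv) => /existsP[? /and3P[]].
have /cov/le_mGP[p /and3P[]] := (target_coupleP e u v).2 (conj neq_uv req).
case/lastP: p => [|p v'] S_p; first by rewrite /= (negbTE neq_uv).
rewrite last_rcons size_rcons => + /eqP eq_v; rewrite {v'}eq_v in S_p * => uniq_p size_p.
have e_p : path e u (rcons p v) by apply: sub_path S_p => x y /and3P[].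
case: p => [|x q] in S_p uniq_p size_p e_p *; first by rewrite /= (negbTE not_e_uv) in e_p.
have q_D : {subset x :: q <= D}.
  move=> y y_q; have /allP/(_ y) := all_induced_path S_p.
  rewrite mem_rcons inE y_q orbT => /(_ isT).
  rewrite !inE => /or3P[//|/eqP eq_yu|/eqP eq_yv].
    by move: uniq_p; rewrite cons_uniq mem_rcons inE -eq_yu y_q orbT.
  by move: uniq_p; rewrite cons_uniq rcons_uniq -eq_yv y_q andbF.
move: e_p; rewrite /= rcons_path => /and3P[e_ux e_q e_qv].
have [|//|w [e_w w_q reach_w]] := @walk_pad e k x q.
  exact: sub_path (@sub_looped e) _ _ e_q.
exists w; split=> // [y /w_q/q_D//|].
by rewrite reach_w inE /= !sub_looped.
Qed.

Lemma feasible_walkP e k D : symmetric e ->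
  feasible k.+1 e D <-> forall p : V * V, p \in required e ->
    exists w, [/\ walk e k w, {subset w <= D} & p \in reach e w].
Proof.
move=> sym_e; split=> [feas [u v] req|covered].
  have [<-|neq_uv] := eqVneq u v; first exact: feasible_diag_walk sym_e feas.
  exact: feasible_target_walk feas neq_uv req.
split=> [x x_D|u v /target_coupleP[_ /covered[w [e_w w_D reach_w]]]].
  have [|w [e_w w_D reach_w]] := covered (x, x); first by rewrite !inE eqxx.
  exact: walk_dominates e_w w_D reach_w x_D.
exact: walk_covers e_w w_D reach_w.
Qed.

Lemma feasible_card_gt0 e k D : 0 < #|V| -> feasible k e D -> 0 < #|D|.
Proof.
move=> /card_gt0P[x _] [dom _]; apply/card_gt0P.
by have [x_D|/dom[y y_D _]] := boolP (x \in D); [exists x|exists y].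
Qed.

Lemma feasible_coverable e k D : symmetric e -> feasible k.+1 e D ->
  coverable (reach e) (walk e k) (required e) (#|D| ^ k.+1).
Proof.
move=> sym_e /(feasible_walkP _ _ sym_e) covered.
exists [seq w <- [seq codom f | f : {ffun 'I_k.+1 -> V} in ffun_on (mem D)] | walk e k w].
split; last 2 first.
- exact: filter_all.
- apply/fintype.subsetP => p /covered[w [e_w w_D reach_w]].
  rewrite (big_rem w) /= ?finset.in_setU ?reach_w // mem_filter e_w /=.
  have /andP[size_w _] := e_w; pose t := Tuple size_w.
  apply/mapP; exists [ffun i => tnth t i]; last first.
    by rewrite codomE (eq_map (ffunE _)) map_tnth_enum.
  by rewrite mem_enum; apply/ffun_onP => i; rewrite ffunE; apply/w_D/(mem_tnth i t).
rewrite size_filter (leq_trans (count_size _ _)) //.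
by rewrite size_map -cardE card_ffun_on card_ord.
Qed.


Lemma covering_feasible e k ws :
  symmetric e -> all (walk e k) ws ->
  uncovered (reach e) (required e) ws = finset.set0 ->
  feasible k.+1 e [set x in flatten ws].
Proof.
move=> sym_e /allP walks /eqP; rewrite finset.setD_eq0 => /fintype.subsetP covered.
apply/(feasible_walkP _ _ sym_e) => p /covered/mem_bigcup_seq[w w_ws reach_w].
exists w; split=> [||//]; first exact: walks.
by move=> x x_w; rewrite inE; apply/flattenP; exists w.
Qed.

End Walks.

(** * Running time of machine programs *)

Definition halts_within (c : prog) (s : state) (T : nat) (Q : state -> Prop) : Prop :=
  exists t s', [/\ exec c s t s', t <= T & Q s'].

Lemma halts_within_weaken c s T T' (Q Q' : state -> Prop) :
  T <= T' -> (forall s', Q s' -> Q' s') ->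
  halts_within c s T Q -> halts_within c s T' Q'.
Proof.
by move=> leT QQ' [t [s' [run le_t /QQ' Qs]]]; exists t, s'; rewrite (leq_trans le_t).
Qed.

Lemma halts_within_step c s s' (Q : state -> Prop) :
  exec c s 1 s' -> Q s' -> halts_within c s 1 Q.
Proof. by exists 1, s'. Qed.

Lemma halts_within_seq c1 c2 s T1 T2 (Q : state -> Prop) :
  halts_within c1 s T1 (fun s1 => halts_within c2 s1 T2 Q) ->
  halts_within (Seq c1 c2) s (T1 + T2) Q.
Proof.
move=> [t1 [s1 [run1 le1 [t2 [s2 [run2 le2 Qs]]]]]].
by exists (t1 + t2), s2; split=> //; [exact: ExecSeq run2 | exact: leq_add].
Qed.

Lemma halts_within_step_seq c1 c2 s s1 T (Q : state -> Prop) :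
  exec c1 s 1 s1 -> halts_within c2 s1 T Q -> halts_within (Seq c1 c2) s T.+1 Q.
Proof. by move=> run1 run2; exact/(@halts_within_seq _ _ _ 1)/(halts_within_step run1). Qed.

Lemma halts_within_if x b c1 c2 s T1 T2 (Q : state -> Prop) :
  (reg s x != 0) = b ->
  (b -> halts_within c1 s T1 Q) -> (~~ b -> halts_within c2 s T2 Q) ->
  halts_within (If x c1 c2) s (T1 + T2).+1 Q.
Proof.
case: b => test run1 run2.
  have [t [s' [run_t le_t Qs]]] := run1 isT; exists t.+1, s'; split=> //.
    exact: ExecIfT.
  by rewrite ltnS (leq_trans le_t) ?leq_addr.
have [t [s' [run_t le_t Qs]]] := run2 isT; exists t.+1, s'; split=> //.
  by apply: ExecIfF => //; apply/eqP/negbFE.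
by rewrite ltnS (leq_trans le_t) ?leq_addl.
Qed.

Lemma halts_within_while x c N T (I : nat -> state -> Prop) s :
  (forall k s1, I k s1 -> reg s1 x = k) ->
  (forall k s1, k < N -> I k.+1 s1 -> halts_within c s1 T (I k)) ->
  I N s -> halts_within (While x c) s (N * T.+1).+1 (I 0).
Proof.
move=> Ix; elim: N s => [|N IH] s body IN.
  by exists 1, s; split=> //; constructor; exact: Ix.
have [t1 [s1 [run1 le1 I1]]] := body N s (leqnn _) IN.
have [|t2 [s2 [run2 le2 I2]]] := IH s1 _ I1.
  by move=> k s' kN; apply: body; exact: ltnW.
exists (t1 + t2).+1, s2; split=> //; last lia.
by apply: ExecWhileT run1 run2; rewrite (Ix _ _ IN).
Qed.

(** * A loop language on vertex tables *)

Record store (n : nat) : Type := Store {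
  table : nat -> {set 'I_n.+1 * 'I_n.+1};
  counter : nat -> nat }.

Definition set_table n (a : store n) t (S : {set 'I_n.+1 * 'I_n.+1}) : store n :=
  Store (fun t' => if t' == t then S else table a t') (counter a).

Definition set_counter n (a : store n) i k : store n :=
  Store (table a) (fun i' => if i' == i then k else counter a i').

(* Loop variables are de Bruijn indices: 0 is the variable of the innermost
   enclosing Foreach. *)
Inductive cmd : Type :=
| Nop
| Mark of nat & nat & nat
| Unmark of nat & nat & nat
| Reset of nat
| Incr of nat
| Decr of nat
| Then of cmd & cmd
| IfMarked of nat & nat & nat & cmd & cmd
| IfLess of nat & nat & cmd & cmd
| Foreach of cmd.

(* An index pointing outside all loops denotes the vertex 0. *)
Fixpoint run n (c : cmd) (env : seq 'I_n.+1) (a : store n) : store n :=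
  let x := nth ord0 env in
  match c with
  | Nop => a
  | Mark t i j => set_table a t ((x i, x j) |: table a t)
  | Unmark t i j => set_table a t (table a t :\ (x i, x j))
  | Reset i => set_counter a i 0
  | Incr i => set_counter a i (counter a i).+1
  | Decr i => set_counter a i (counter a i).-1
  | Then c1 c2 => run c2 env (run c1 env a)
  | IfMarked t i j c1 c2 =>
      if (x i, x j) \in table a t then run c1 env a else run c2 env a
  | IfLess i j c1 c2 =>
      if counter a i < counter a j then run c1 env a else run c2 env a
  | Foreach c => foldl (fun a x => run c (x :: env) a) a (enum 'I_n.+1)
  end.

(** * Compilation to the machine *)

(* As the machine cannot multiply, each loop variable comes with its multiple by
   the number of vertices, and rSquare holds the size of a table. *)
Local Notation rSize := 0 (only parsing).
Local Notation rOne := 1 (only parsing).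
Local Notation rSquare := 2 (only parsing).
Local Notation rTest := 3 (only parsing).
Local Notation rAddr := 4 (only parsing).
Local Notation rIndex d := (3 * d + 5) (only parsing).
Local Notation rRow d := (3 * d + 6) (only parsing).
Local Notation rCounter i := (3 * i + 7) (only parsing).

Fixpoint address (t x y : nat) : prog :=
  if t is t'.+1 then Seq (address t' x y) (Add rAddr rAddr rSquare)
  else Add rAddr (rRow x) (rIndex y).

Definition advance (d : nat) : prog :=
  Seq (Add (rIndex d) (rIndex d) rOne)
    (Seq (Add (rRow d) (rRow d) rSize) (Defs.Sub rTest rSize (rIndex d))).

Definition counting_loop (d : nat) (c : prog) : prog :=
  Seq (Const (rIndex d) 0) (Seq (Const (rRow d) 0)
    (Seq (Defs.Sub rTest rSize (rIndex d)) (While rTest (Seq c (advance d))))).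

(* Below d loops the variable i lives at level d - i.  The levels start at 1, so
   that the truncated subtraction sends escaping indices to level 0, whose
   registers are never written and hold 0. *)
Fixpoint compile (d : nat) (c : cmd) : prog :=
  match c with
  | Nop => Skip
  | Mark t i j => Seq (address t (d - i) (d - j)) (Write rAddr rOne)
  | Unmark t i j =>
      Seq (address t (d - i) (d - j)) (Seq (Const rTest 0) (Write rAddr rTest))
  | Reset i => Const (rCounter i) 0
  | Incr i => Add (rCounter i) (rCounter i) rOne
  | Decr i => Defs.Sub (rCounter i) (rCounter i) rOne
  | Then c1 c2 => Seq (compile d c1) (compile d c2)
  | IfMarked t i j c1 c2 =>
      Seq (address t (d - i) (d - j))
        (Seq (Read rTest rAddr) (If rTest (compile d c1) (compile d c2)))
  | IfLess i j c1 c2 =>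
      Seq (Defs.Sub rTest (rCounter j) (rCounter i))
        (If rTest (compile d c1) (compile d c2))
  | Foreach c => counting_loop d.+1 (compile d.+1 c)
  end.

Fixpoint cost (c : cmd) : {poly nat} :=
  match c with
  | Nop | Reset _ | Incr _ | Decr _ => 1
  | Mark t _ _ => t.+2%:P
  | Unmark t _ _ => t.+3%:P
  | Then c1 c2 => cost c1 + cost c2
  | IfMarked t _ _ c1 c2 => t.+3%:P + (cost c1 + cost c2)
  | IfLess _ _ c1 c2 => 2%:P + (cost c1 + cost c2)
  | Foreach c => 4%:P + 'X * (cost c + 4%:P)
  end%R.

Section Compilation.

Variable n : nat.
Implicit Types (x : 'I_n.+1) (p : 'I_n.+1 * 'I_n.+1) (env : seq 'I_n.+1).
Implicit Types (a : store n) (s : state).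

Definition cell (t : nat) p : nat := t * (n.+1 * n.+1) + (p.1 * n.+1 + p.2).

Lemma cell_eq t t' p p' : (cell t p == cell t' p') = (t == t') && (p == p').
Proof.
apply/eqP/andP => [eq_cell|[/eqP-> /eqP->] //].
have off_lt (q : 'I_n.+1 * 'I_n.+1) : q.1 * n.+1 + q.2 < n.+1 * n.+1.
  by have := ltn_ord q.1; have := ltn_ord q.2; nia.
have eq_t : t = t'.
  by have := congr1 (divn^~ (n.+1 * n.+1)) eq_cell;
    rewrite !divnMDl ?muln_gt0 // !divn_small ?addn0.
have /addnI eq_off : t * (n.+1 * n.+1) + (p.1 * n.+1 + p.2) =
  t * (n.+1 * n.+1) + (p'.1 * n.+1 + p'.2) by rewrite -/(cell t p) eq_cell eq_t.
have eq1 : p.1 = p'.1.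
  by apply/val_inj; have := congr1 (divn^~ n.+1) eq_off;
    rewrite !divnMDl // !divn_small ?addn0.
have eq2 : p.2 = p'.2 by apply/val_inj; move: eq_off; rewrite eq1 => /addnI.
by rewrite eq_t eqxx -pair_eqE /= eq1 eq2 !eqxx.
Qed.

Record represents env a s : Prop := Represents {
  rep_size : reg s rSize = n.+1;
  rep_one : reg s rOne = 1;
  rep_square : reg s rSquare = n.+1 * n.+1;
  rep_index i : reg s (rIndex (size env - i)) = nth ord0 env i;
  rep_row i : reg s (rRow (size env - i)) = nth ord0 env i * n.+1;
  rep_counter i : reg s (rCounter i) = counter a i;
  rep_table t p : (Defs.mem s (cell t p) != 0) = (p \in table a t) }.

Lemma upd_same (f : nat -> nat) r k : upd f r k r = k.
Proof. by rewrite /upd eqxx. Qed.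

Lemma upd_other (f : nat -> nat) r r' k : r' != r -> upd f r k r' = f r'.
Proof. by rewrite /upd => /negbTE->. Qed.

Lemma represents_scratch env a s r k :
  r \in [:: rTest; rAddr; rIndex (size env).+1; rRow (size env).+1] ->
  represents env a s -> represents env a (set_reg s r k).
Proof.
rewrite !inE => scratch [size_s one_s square_s index_s row_s counter_s table_s].
by split=> //= *; rewrite upd_other //; lia.
Qed.

Lemma represents_push x env a s :
  reg s (rIndex (size env).+1) = x -> reg s (rRow (size env).+1) = x * n.+1 ->
  represents env a s -> represents (x :: env) a s.
Proof.
move=> index_x row_x; case=> size_s one_s square_s index_s row_s counter_s table_s.
by split=> // -[|i]; rewrite ?subn0 //= subSS.
Qed.

Lemma represents_pop x env a s : represents (x :: env) a s -> represents env a s.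
Proof.
case=> size_s one_s square_s index_s row_s counter_s table_s.
by split=> // i; [exact: (index_s i.+1) | exact: (row_s i.+1)].
Qed.

Lemma represents_set_counter env a s i k :
  represents env a s -> represents env (set_counter a i k) (set_reg s (rCounter i) k).
Proof.
case=> size_s one_s square_s index_s row_s counter_s table_s.
split=> //= *; try by rewrite upd_other //; lia.
by rewrite /upd eqn_add2r eqn_mul2l counter_s.
Qed.

Lemma represents_set_mem env a s t p k S :
  S = (if k != 0 then p |: table a t else table a t :\ p) -> represents env a s ->
  represents env (set_table a t S) (Defs.set_mem s (cell t p) k).
Proof.
move=> -> [size_s one_s square_s index_s row_s counter_s table_s].
split=> //= t' p'; rewrite /upd cell_eq; have [->|_] /= := eqVneq t' t; last exact: table_s.
by have [->|k0] := eqVneq k 0; rewrite /= !inE -table_s; case: (p' == p); rewrite ?k0.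
Qed.

Lemma address_correct env a s t i j :
  represents env a s ->
  halts_within (address t (size env - i) (size env - j)) s t.+1 (fun s' =>
    represents env a s' /\ reg s' rAddr = cell t (nth ord0 env i, nth ord0 env j)).
Proof.
move=> reps; elim: t => [|t IH] /=.
  apply: halts_within_step (ExecAdd _ _ _ _) _; split; first exact: represents_scratch.
  by rewrite /= upd_same (rep_row reps) (rep_index reps).
rewrite -[t.+2]addn1; apply/halts_within_seq.
apply: halts_within_weaken IH => // s1 [reps1 addr1].
apply: halts_within_step (ExecAdd _ _ _ _) _; split; first exact: represents_scratch.
by rewrite /= upd_same addr1 (rep_square reps1) /cell /=; lia.
Qed.

Definition at_iteration env a m s : Prop :=
  [/\ represents env a s, reg s rTest = n.+1 - m, reg s (rIndex (size env).+1) = m &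
      reg s (rRow (size env).+1) = m * n.+1].

Lemma advance_correct x env a s :
  represents (x :: env) a s ->
  halts_within (advance (size env).+1) s 3 (at_iteration env a x.+1).
Proof.
move=> reps; do 2!(apply: halts_within_step_seq; first by constructor).
apply: halts_within_step; first by constructor.
have [size_s one_s] := (rep_size reps, rep_one reps).
have := rep_index reps 0; have := rep_row reps 0; rewrite !subn0 /= => row_s index_s.
split; try by rewrite /= /upd; do !case: eqP => ?; lia.
do 3!(apply: represents_scratch; first by rewrite !inE eqxx ?orbT).
exact: represents_pop reps.
Qed.

Lemma counting_loop_correct env c T (f : store n -> 'I_n.+1 -> store n) a s :
  (forall x a1 s1, represents (x :: env) a1 s1 ->
     halts_within c s1 T (represents (x :: env) (f a1 x))) ->
  represents env a s ->
  halts_within (counting_loop (size env).+1 c) s (4 + n.+1 * (T + 4))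
    (represents env (foldl f a (enum 'I_n.+1))).
Proof.
move=> body reps; do 3!(apply: halts_within_step_seq; first by constructor).
pose todo k := drop (n.+1 - k) (enum 'I_n.+1).
pose I k s1 := reg s1 rTest = k /\ exists2 a1, at_iteration env a1 (n.+1 - k) s1 &
  foldl f a1 (todo k) = foldl f a (enum 'I_n.+1).
have size_s := rep_size reps; set s0 := set_reg _ rTest _.
have I0 : I n.+1 s0.
  split; first by rewrite /= /upd; do !case: eqP => ?; lia.
  exists a; last by rewrite /todo subnn drop0.
  split; try by rewrite /= /upd; do !case: eqP => ?; lia.
  by do 3!(apply: represents_scratch; first by rewrite !inE eqxx ?orbT).
apply: halts_within_weaken (halts_within_while (T := T + 3) (I := I) _ _ I0); first lia.
- move=> s' [_ [a1 [reps1 _ _ _]]].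
  by rewrite /todo subn0 drop_oversize ?size_enum_ord // => <-.
- by move=> k s1 [].
move=> k s1 lekn [_ [a1 [reps1 _ index1 row1] todo1]].
have lt_x : n.+1 - k.+1 < n.+1 by rewrite ltn_subrL.
pose x := Ordinal lt_x.
have todoS : todo k.+1 = x :: todo k.
  by rewrite /todo (drop_nth x) ?size_enum_ord // (nth_ord_enum x x) subnSK.
apply/halts_within_seq; apply: halts_within_weaken (body x a1 s1 _) => //;
  last exact: represents_push.
move=> s2 /advance_correct; apply: halts_within_weaken => // s3 iter3.
have [_ test3 _ _] := iter3; split; first by rewrite test3 /=; lia.
exists (f a1 x); last by rewrite -todo1 todoS.
by rewrite -(subnSK lekn).
Qed.

Lemma compile_correct c env a s :
  represents env a s ->
  halts_within (compile (size env) c) s (cost c).[n.+1]%R (represents env (run c env a)).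
Proof.
elim: c env a s => [|t i j|t i j|i|i|i|c1 IH1 c2 IH2|t i j c1 IH1 c2 IH2
    |i j c1 IH1 c2 IH2|c IH] env a s reps /=;
  rewrite ?(hornerD, hornerM, hornerX, hornerC, natrDE, natrME).
- by apply: halts_within_step reps; constructor.
- rewrite -[t.+2]addn1; apply/halts_within_seq.
  apply: halts_within_weaken (address_correct t i j reps) => // s1 [reps1 addr1].
  apply: halts_within_step; first by constructor.
  by rewrite addr1 (rep_one reps1); exact: represents_set_mem.
- rewrite -[t.+3]addn2; apply/halts_within_seq.
  apply: halts_within_weaken (address_correct t i j reps) => // s1 [reps1 addr1].
  apply: halts_within_step_seq; first by constructor.
  apply: halts_within_step; first by constructor.
  rewrite /= upd_same upd_other // addr1.
  by apply: represents_set_mem; rewrite //; exact: represents_scratch.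
- by apply: halts_within_step (represents_set_counter _ _ reps); constructor.
- apply: halts_within_step; first by constructor.
  by rewrite (rep_one reps) (rep_counter reps) addn1; exact: represents_set_counter.
- apply: halts_within_step; first by constructor.
  by rewrite (rep_one reps) (rep_counter reps) subn1; exact: represents_set_counter.
- apply/halts_within_seq; apply: halts_within_weaken (IH1 _ _ _ reps) => // s1.
  exact: IH2.
- rewrite -[t.+3]addn2 -addnA; apply/halts_within_seq.
  apply: halts_within_weaken (address_correct t i j reps) => // s1 [reps1 addr1].
  apply: halts_within_step_seq; first by constructor.
  set s2 := set_reg _ _ _; have reps2 : represents env a s2 by exact: represents_scratch.
  have test2 : (reg s2 rTest != 0) = ((nth ord0 env i, nth ord0 env j) \in table a t).
    by rewrite -(rep_table reps2) /= upd_same addr1.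
  by apply: (halts_within_if test2) => [->|/negbTE->]; [exact: IH1 | exact: IH2].
- apply: halts_within_step_seq; first by constructor.
  set s2 := set_reg _ _ _; have reps2 : represents env a s2 by exact: represents_scratch.
  have test2 : (reg s2 rTest != 0) = (counter a i < counter a j).
    by rewrite /= upd_same !(rep_counter reps) subn_eq0 -ltnNge.
  by apply: (halts_within_if test2) => [->|/negbTE->]; [exact: IH1 | exact: IH2].
- by apply: counting_loop_correct reps => x a1 s1; exact: IH.
Qed.

End Compilation.

Definition init_registers : prog :=
  Seq (Const rOne 1) (Seq (Add rTest rSize (rIndex 0)) (While rTest
    (Seq (Add rSquare rSquare rSize) (Defs.Sub rTest rTest rOne)))).

Definition init_registers_cost : {poly nat} := (3%:P + 'X * 3%:P)%R.

Definition program (c : cmd) : prog := Seq init_registers (compile 0 c).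

Definition program_cost (c : cmd) : {poly nat} := (init_registers_cost + cost c)%R.

Section Program.

Variables (n : nat) (e : rel 'I_n.+1).

Definition graph_store : store n :=
  Store (fun t => if t == 0 then edge_set e else finset.set0) (fun=> 0).

(* Row 0 of table 1 occupies the cells that output_set reads. *)
Definition output (c : cmd) : {set 'I_n.+1} :=
  [set x | (ord0, x) \in table (run c [::] graph_store) 1].

Lemma input_state_cell t p :
  (Defs.mem (input_state e) (cell t p) != 0) = (p \in table graph_store t).
Proof.
have cell0 (i j : 'I_n.+1) : i * n.+1 + j = cell 0 (i, j) by [].
rewrite /= eqb0 negbK; apply/existsP/idP => [[i /existsP[j]]|].
  rewrite cell0 cell_eq => /andP[/andP[/eqP-> /eqP->]].
  by rewrite inE.
case: eqP => [->|]; rewrite inE // => e_p.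
by exists p.1; apply/existsP; exists p.2; rewrite cell0 -surjective_pairing eqxx.
Qed.

Lemma init_registers_correct :
  halts_within init_registers (input_state e) init_registers_cost.[n.+1]%R
    (represents [::] graph_store).
Proof.
rewrite /init_registers_cost !(hornerD, hornerM, hornerX, hornerC).
do 2!(apply: halts_within_step_seq; first by constructor).
pose I k s := [/\ reg s rTest = k, reg s rSquare = (n.+1 - k) * n.+1,
  Defs.mem s = Defs.mem (input_state e), reg s rOne = 1 &
  forall r, r \notin [:: rOne; rSquare; rTest] -> reg s r = if r == 0 then n.+1 else 0].
set s0 := set_reg _ rTest _.
have I0 : I n.+1 s0.
  split; rewrite ?subnn //=; first exact: addn0.
  by move=> r; rewrite !inE !negb_or => /and3P[? ? ?]; rewrite !upd_other.
apply: halts_within_weaken (halts_within_while (T := 2) (I := I) _ _ I0) => //.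
- move=> s [_ square mem_s one others].
  split=> [||| i | i | i | t p]; try by rewrite others ?nth_nil ?inE ?addnS.
  + exact: one.
  + by rewrite square subn0.
  + by rewrite mem_s input_state_cell.
- by move=> k s [].
move=> k s lekn [test square mem_s one others].
apply: halts_within_step_seq; first by constructor.
apply: halts_within_step; first by constructor.
split=> //=.
- by rewrite /upd /= test one subn1.
- by rewrite /upd /= square others //=; nia.
by move=> r r_other; rewrite !upd_other ?others //;
  move: r_other; rewrite !inE !negb_or => /and3P[].
Qed.

Lemma program_correct (c : cmd) :
  exists t s, [/\ exec (program c) (input_state e) t s, t <= (program_cost c).[n.+1]%R &
    output_set n.+1 s = output c].
Proof.
have [t [s [run_c le_t reps]]] : halts_within (program c) (input_state e)
    (program_cost c).[n.+1]%R (represents [::] (run c [::] graph_store)).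
  rewrite /program_cost hornerD; apply/halts_within_seq.
  by apply: halts_within_weaken init_registers_correct => // s1; exact: compile_correct.
exists t, s; split=> //; apply/setP => x.
by rewrite !inE -(rep_table reps) /cell mul1n.
Qed.

End Program.

Lemma program_approx (R : realType) (alpha : nat) (r : nat -> R) (c : cmd) :
  (forall n (e : rel 'I_n.+1), simple_graph e ->
    feasible alpha e (output e c) /\ forall Dopt, optimal alpha e Dopt ->
      (#|output e c|%:R <= r n.+1 * #|Dopt|%:R :> R)%R) ->
  polytime_approx alpha r (program c).
Proof.
move=> approx; exists (program_cost c) => n e simple_e [V0 _].
case: n e simple_e V0 => [e _|n e simple_e _]; first by rewrite card_ord.
have [t [s [run_c le_t outE]]] := program_correct e c.
by have [feas opt] := approx n e simple_e; exists t, s; rewrite outE.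
Qed.

(** * The algorithm *)

(* The first three number tables, the last two number counters; edges and chosen
   are imposed by graph_store and output. *)
Local Notation edges := 0 (only parsing).
Local Notation chosen := 1 (only parsing).
Local Notation pending := 2 (only parsing).
Local Notation gained := 0 (only parsing).
Local Notation threshold := 1 (only parsing).

Definition mark_wedges : cmd :=
  Foreach (Foreach (Foreach
    (IfMarked edges 2 0
      (IfMarked edges 0 1 (IfMarked edges 2 1 Nop (Mark pending 2 1)) Nop) Nop))).

Definition mark_diagonal : cmd := Foreach (Then (Mark edges 0 0) (Mark pending 0 0)).

Fixpoint if_path (i m : nat) (c : cmd) : cmd :=
  if m is m'.+1 then IfMarked edges i i.+1 (if_path i.+1 m' c) Nop else c.

(* The k.+1 innermost variables hold a walk of length k; c sees in addition a pair
   reached by it, as the variables 1 and 0. *)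
Definition for_reached (k : nat) (c : cmd) : cmd :=
  Foreach (Foreach (IfMarked edges 1 2 (IfMarked edges k.+2 0 c Nop) Nop)).

Definition count_gain (k : nat) : cmd :=
  for_reached k (IfMarked pending 1 0 (Incr gained) Nop).

Definition unmark_reached (k : nat) : cmd := for_reached k (Unmark pending 1 0).

Fixpoint choose_prefix (m : nat) : cmd :=
  if m is m'.+1 then Then (choose_prefix m') (Mark chosen 0 m'.+1) else Nop.

(* The loop fills the columns of the chosen vertices, so that row 0, which is the
   output, lists these vertices. *)
Definition choose_walk (k : nat) : cmd := Foreach (choose_prefix k.+1).

Definition visit_walk (k : nat) : cmd :=
  Then (Reset gained) (Then (count_gain k)
    (IfLess gained threshold Nop (Then (choose_walk k) (unmark_reached k)))).

Definition greedy_pass (k : nat) : cmd := iter k.+1 Foreach (if_path 0 k (visit_walk k)).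

Definition initialize : cmd :=
  Then mark_wedges (Then mark_diagonal (Foreach (Foreach (Incr threshold)))).

Definition greedy_cover (k : nat) : cmd :=
  Then initialize (Foreach (Foreach (Then (greedy_pass k) (Decr threshold)))).

Lemma foldl_big (X : Type) (idx : X) (op : Monoid.law idx) (A I : Type)
    (f : A -> I -> A) (F : I -> X) (J : X -> A -> Prop) (s : seq I) y a :
  (forall i y a, J y a -> J (op y (F i)) (f a i)) ->
  J y a -> J (op y (\big[op/idx]_(i <- s) F i)) (foldl f a s).
Proof.
move=> step; elim: s y a => [|i s IH] y a Jya; first by rewrite big_nil Monoid.mulm1.
by rewrite big_cons Monoid.mulmA; apply/IH/step.
Qed.

Lemma foldl_inv (A : Type) (I : eqType) (f : A -> I -> A) (inv : A -> Prop)
    (post : I -> A -> Prop) (s : seq I) a :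
  {in s, forall i a, inv a -> inv (f a i) /\ post i (f a i)} ->
  {in s &, forall i j a, inv a -> post i a -> post i (f a j)} ->
  inv a -> inv (foldl f a s) /\ {in s, forall i, post i (foldl f a s)}.
Proof.
elim/last_ind: s => [|s j IH] // step keep inv_a; rewrite foldl_rcons.
have sub_s : {subset s <= rcons s j} by move=> i i_s; rewrite mem_rcons inE i_s orbT.
have j_s : j \in rcons s j by rewrite mem_rcons mem_head.
have [i i_s|i i' i_s i'_s|inv_s post_s] := IH _ _ inv_a.
- exact/step/sub_s.
- by apply: keep; exact: sub_s.
have [inv_j post_j] := step j j_s _ inv_s; split=> // i.
rewrite mem_rcons inE => /predU1P[->//|i_s].
by apply: keep; [exact: sub_s | | | exact: post_s].
Qed.

Lemma foldl_allpairs (A I1 I2 I : Type) (f : A -> I -> A) (g : I1 -> I2 -> I)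
    (s : seq I1) (t : seq I2) a :
  foldl f a [seq g i j | i <- s, j <- t] =
  foldl (fun a i => foldl (fun a j => f a (g i j)) a t) a s.
Proof.
elim: s a => //= i s IH a; rewrite foldl_cat IH; congr foldl.
by elim: (t) a => //= j t' IHt a.
Qed.

Fixpoint words (T : finType) (m : nat) : seq (seq T) :=
  if m is m'.+1 then [seq x :: w | w <- words T m', x <- enum T] else [:: [::]].

Lemma mem_words (T : finType) m (w : seq T) : (w \in words T m) = (size w == m).
Proof.
elim: m w => [|m IH] [|x w] //=; rewrite ?inE //.
  by apply/allpairsP => -[[? ?] []].
rewrite eqSS -IH; apply/allpairsP/idP => [[[w' x'] /= [w'_m _ [_ ->]]]//|w_m].
by exists (w, x); rewrite mem_enum.
Qed.

Section Runs.

Variable n : nat.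
Implicit Types (a : store n) (env w : seq 'I_n.+1) (c : cmd).

Lemma run_foreach_big (X : Type) (idx : X) (op : Monoid.com_law idx)
    (J : X -> store n -> Prop) (F : 'I_n.+1 -> X) c env y a :
  (forall x y a, J y a -> J (op y (F x)) (run c (x :: env) a)) ->
  J y a -> J (op y (\big[op/idx]_x F x)) (run (Foreach c) env a).
Proof. by move=> step Jya; rewrite -big_enum; exact: foldl_big. Qed.

Lemma run_iter_foreach m c env a :
  run (iter m Foreach c) env a =
  foldl (fun a w => run c (w ++ env) a) a (words 'I_n.+1 m).
Proof.
by elim: m c a => [//|m IH] c a; rewrite iterSr IH [RHS]foldl_allpairs.
Qed.

Definition holds (E C U : {set 'I_n.+1 * 'I_n.+1}) (K : nat) a : Prop :=
  [/\ table a edges = E, table a chosen = C, table a pending = U & counter a threshold = K].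

Variable e : rel 'I_n.+1.

Lemma run_mark_wedges C K env a :
  holds (edge_set e) C finset.set0 K a ->
  holds (edge_set e) C (open_wedges e) K (run mark_wedges env a).
Proof.
move=> holds_a; pose J U := holds (edge_set e) C U K.
pose F u v y := if [&& e u y, e y v & ~~ e u v] then [set (u, v)] else finset.set0.
have runJ : J (\bigcup_u \bigcup_v \bigcup_y F u v y) (run mark_wedges env a).
  rewrite -[X in J X _]finset.set0U; apply: (run_foreach_big (J := J)) holds_a => u Y1 a1.
  apply: (run_foreach_big (J := J)) => v Y2 a2; apply: (run_foreach_big (J := J)) => y Y3 a3.
  move=> [edges3 chosen3 pending3 threshold3].
  rewrite /= edges3 !inE /= /F; case: (e u y); case: (e y v); case: (e u v) => /=;
    by rewrite ?finset.setU0; split=> //=; rewrite pending3 finset.setUC.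
suff <- : \bigcup_u \bigcup_v \bigcup_y F u v y = open_wedges e by [].
apply/setP => -[u v]; rewrite inE; apply/finset.bigcupP/existsP => /=.
  case=> u' _ /finset.bigcupP[v' _ /finset.bigcupP[y _]]; rewrite /F.
  by case: ifP; rewrite inE // => uyv /eqP[-> ->]; exists y.
case=> y uyv; exists u => //; apply/finset.bigcupP; exists v => //.
by apply/finset.bigcupP; exists y; rewrite // /F uyv inE.
Qed.

Lemma run_mark_diagonal C U K env a :
  holds (edge_set e) C U K a ->
  holds (edge_set (looped e)) C (diagonal _ :|: U) K (run mark_diagonal env a).
Proof.
move=> [edges_a chosen_a pending_a threshold_a].
pose J D := holds (D :|: edge_set e) C (D :|: U) K.
have runJ : J (\bigcup_x [set (x, x)]) (run mark_diagonal env a).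
  rewrite -[X in J X _]finset.set0U; apply: (run_foreach_big (J := J)) => [x D a1|].
    move=> [edges1 chosen1 pending1 threshold1].
    by split; rewrite //= ?edges1 ?pending1 finset.setUA [D :|: _]finset.setUC.
  by split; rewrite ?finset.set0U.
have diagE : \bigcup_x [set (x, x)] = diagonal 'I_n.+1.
  apply/setP => -[u v]; rewrite inE; apply/finset.bigcupP/eqP => /= [[x _]|->].
    by rewrite inE => /eqP[-> ->].
  by exists v; rewrite // inE.
by rewrite edge_set_looped -diagE.
Qed.

Lemma run_init_threshold E C U env a :
  holds E C U 0 a ->
  holds E C U (n.+1 * n.+1) (run (Foreach (Foreach (Incr threshold))) env a).
Proof.
move=> holds_a; pose J K := holds E C U K.
have -> : n.+1 * n.+1 = 0 + \sum_(x < n.+1) \sum_(y < n.+1) 1.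
  by rewrite !sum_nat_const card_ord muln1.
apply: (run_foreach_big (J := J)) holds_a => x K a1.
apply: (run_foreach_big (J := J)) => y K1 a2 [? ? ? threshold2].
by split; rewrite //= threshold2 addn1.
Qed.

Lemma run_if_path E C U K c p x q env a :
  holds (edge_set E) C U K a ->
  run (if_path (size p) (size q) c) (p ++ x :: q ++ env) a =
  if path E x q then run c (p ++ x :: q ++ env) a else a.
Proof.
move=> [edges_a _ _ _]; elim: q p x => [//|y q IH] p x /=.
rewrite edges_a inE /= !nth_cat ltnn subnn ltnNge leqnSn subSnn /=.
by case: (E x y) => //=; rewrite -cat_rcons -(size_rcons p x) IH.
Qed.

Lemma run_for_reached (X : Type) (idx : X) (op : Monoid.com_law idx)
    (J : X -> store n -> Prop) (F : 'I_n.+1 * 'I_n.+1 -> X) c k w env y a :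
  size w = k.+1 -> (forall y a, J y a -> table a edges = edge_set (looped e)) ->
  (forall p y a, p \in reach e w -> J y a ->
     J (op y (F p)) (run c [:: p.2, p.1 & w ++ env] a)) ->
  J y a ->
  J (op y (\big[op/idx]_(p in reach e w) F p)) (run (for_reached k c) (w ++ env) a).
Proof.
case: w => [//|x q] [size_q] edgesJ step Jya.
pose G u v := if (u, v) \in reach e (x :: q) then F (u, v) else idx.
have -> : \big[op/idx]_(p in reach e (x :: q)) F p = \big[op/idx]_u \big[op/idx]_v G u v.
  by rewrite pair_bigA big_mkcond; apply: eq_bigr => -[u v] _.
apply: run_foreach_big Jya => u y1 a1; apply: run_foreach_big => v y2 a2 Jya2.
have last_q : nth ord0 (x :: q ++ env) k = last x q.
  by rewrite -cat_cons nth_cat /= size_q ltnSn (last_nth ord0) size_q.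
have reachE : ((u, v) \in reach e (x :: q)) = looped e u x && looped e (last x q) v.
  by rewrite inE.
have edges_in x' y' : ((x', y') \in table a2 edges) = looped e x' y'.
  by rewrite (edgesJ _ _ Jya2) inE.
rewrite [run _ _ _]/= last_q !edges_in /G reachE.
case ux: (looped e u x) => /=; last by rewrite Monoid.mulm1.
case qv: (looped e (last x q) v); last by rewrite Monoid.mulm1.
by apply: (step (u, v)); rewrite ?reachE ?ux.
Qed.

Lemma run_count_gain C U K k w env a :
  size w = k.+1 -> holds (edge_set (looped e)) C U K a -> counter a gained = 0 ->
  let a' := run (count_gain k) (w ++ env) a in
  holds (edge_set (looped e)) C U K a' /\ counter a' gained = #|reach e w :&: U|.
Proof.
move=> size_w holds_a gained_a a'.
pose J g a := holds (edge_set (looped e)) C U K a /\ counter a gained = g.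
suff runJ : J (0 + \sum_(p in reach e w) (p \in U))%N a'.
  have -> : #|reach e w :&: U| = \sum_(p in reach e w) (p \in U) by
    rewrite -sum1_card big_mkcond [RHS]big_mkcond; apply: eq_bigr => p _;
    rewrite finset.in_setI; case: (p \in reach e w) => //=; case: (p \in U).
  exact: runJ.
apply: (run_for_reached (J := J)) => [//|g a1 [[]] //|[u v] g a1 _ [holds1 gained1]|//].
have [_ _ pending1 _] := holds1; rewrite /= pending1.
by case: ((u, v) \in U); split; rewrite //= gained1 ?addn1 ?addn0.
Qed.

Lemma run_unmark_reached C U K k w env a :
  size w = k.+1 -> holds (edge_set (looped e)) C U K a ->
  holds (edge_set (looped e)) C (U :\: reach e w) K
    (run (unmark_reached k) (w ++ env) a).
Proof.
move=> size_w holds_a.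
pose J Y := holds (edge_set (looped e)) C (U :\: Y) K.
have -> : reach e w = finset.set0 :|: \bigcup_(p in reach e w) [set p].
  rewrite finset.set0U; apply/setP => p; apply/idP/finset.bigcupP => [p_w|[p' p'_w]].
    by exists p; rewrite // inE.
  by rewrite inE => /eqP->.
apply: (run_for_reached (J := J)) => [//|Y a1 [] //|[u v] Y a1 _ []|].
  move=> edges1 chosen1 pending1 threshold1.
  by split; rewrite //= pending1 finset.setDDl.
by rewrite /J finset.setD0.
Qed.

Lemma run_choose_prefix E C U K m z w env a :
  m <= size w -> holds E C U K a ->
  holds E (C :|: [set p | (p.1 == z) && (p.2 \in take m w)]) U K
    (run (choose_prefix m) [:: z & w ++ env] a).
Proof.
move=> size_m holds_a; elim: m size_m => [_|m IH lt_m].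
  rewrite take0 (_ : [set _ | _] = finset.set0) ?finset.setU0 //.
  by apply/setP => p; rewrite !inE andbF.
have [edges1 chosen1 pending1 threshold1] := IH (ltnW lt_m).
split; rewrite //= chosen1 nth_cat lt_m; apply/setP => -[z' y].
rewrite (take_nth ord0) // !inE /= mem_rcons inE xpair_eqE.
by case: (_ \in C); case: (z' == z); case: (y == _).
Qed.

Lemma run_choose_walk E C U K k w env a :
  size w = k.+1 -> holds E C U K a ->
  holds E (C :|: [set p | p.2 \in w]) U K (run (choose_walk k) (w ++ env) a).
Proof.
move=> size_w holds_a; pose J Y := holds E (C :|: Y) U K.
have -> : [set p | p.2 \in w] =
    finset.set0 :|: \bigcup_z [set p : 'I_n.+1 * 'I_n.+1 | (p.1 == z) && (p.2 \in w)].
  rewrite finset.set0U; apply/setP => p; rewrite inE.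
  apply/idP/finset.bigcupP => [p_w|[z _]]; last by rewrite inE => /andP[].
  by exists p.1; rewrite // inE eqxx.
apply: (run_foreach_big (J := J)) => [z Y a1 holds1|]; last by rewrite /J finset.setU0.
have := run_choose_prefix z env (eq_leq (esym size_w)) holds1.
by rewrite take_oversize ?size_w // -finset.setUA.
Qed.

Definition selected (ws : seq (seq 'I_n.+1)) K a : Prop :=
  holds (edge_set (looped e)) [set p | p.2 \in flatten ws]
    (uncovered (reach e) (required e) ws) K a.

Local Notation add_walk k := (add_above (reach e) (walk e k) (required e)).
Local Notation walks_below k := (greedy_below (reach e) (walk e k) (required e)).

Lemma run_visit_walk k K ws w env a :
  walk e k w -> selected ws K a ->
  selected (add_walk k K ws w) K (run (visit_walk k) (w ++ env) a).
Proof.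
move=> walk_w selected_a; have /andP[/eqP size_w _] := walk_w.
pose a0 := set_counter a gained 0; pose a1 := run (count_gain k) (w ++ env) a0.
have selected0 : selected ws K a0 by case: selected_a.
have [holds1 gained1] := run_count_gain env size_w selected0 erefl.
have -> : run (visit_walk k) (w ++ env) a =
    if counter a1 gained < counter a1 threshold then a1
    else run (unmark_reached k) (w ++ env) (run (choose_walk k) (w ++ env) a1) by [].
have [_ _ _ ->] := holds1; rewrite gained1 /add_above walk_w /gain /=.
case: ltnP => // le_Kg; rewrite /selected uncovered_cons.
have -> : [set p | p.2 \in flatten (w :: ws)] =
    [set p | p.2 \in flatten ws] :|: [set p : 'I_n.+1 * 'I_n.+1 | p.2 \in w].
  by apply/setP => p; rewrite !inE mem_cat orbC.
exact/run_unmark_reached/run_choose_walk.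
Qed.

Lemma run_if_path_visit_walk k K ws w env a :
  size w = k.+1 -> selected ws K a ->
  selected (add_walk k K ws w) K (run (if_path 0 k (visit_walk k)) (w ++ env) a).
Proof.
case: w => [//|x q] [size_q] selected_a.
have walkE : walk e k (x :: q) = path (looped e) x q by rewrite /walk /= size_q eqxx.
have -> : run (if_path 0 k (visit_walk k)) ((x :: q) ++ env) a =
    if walk e k (x :: q) then run (visit_walk k) ((x :: q) ++ env) a else a.
  by rewrite walkE -size_q; exact: (run_if_path _ [::] _ _ _ selected_a).
case: ifP => [walk_xq|not_walk]; first exact: run_visit_walk.
by rewrite /add_above not_walk.
Qed.

Lemma run_greedy_pass k K ws env a :
  0 < K -> selected ws K a -> walks_below k K ws ->
  exists2 ws', selected ws' K (run (greedy_pass k) env a) &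
    walks_below k K.-1 ws'.
Proof.
move=> K_gt0 selected_a below_ws; rewrite /greedy_pass run_iter_foreach.
set visit := fun a w => run _ (w ++ env) a.
pose inv a := exists2 ws, selected ws K a &
  walks_below k K ws.
pose post w a := walk e k w -> #|reach e w :&: table a pending| < K.
have visit_selected w ws1 a1 : w \in words _ k.+1 -> selected ws1 K a1 ->
    selected (add_walk k K ws1 w) K (visit a1 w).
  by rewrite mem_words => /eqP size_w; exact: run_if_path_visit_walk.
have [w w_k||| [ws' selected' below'] post'] :=
  @foldl_inv _ _ visit inv post (words _ k.+1) a.
- move=> a1 [ws1 selected1 below1]; have selected2 := visit_selected _ _ _ w_k selected1.
  split; first by exists (add_walk k K ws1 w) => //; exact: greedy_below_add.
  by rewrite /post; have [_ _ -> _] := selected2; exact: gain_add_above_same.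
- move=> w w' _ w'_k a1 [ws1 selected1 _] post1 walk_w.
  have [_ _ -> _] := visit_selected _ _ _ w'_k selected1.
  have := post1 walk_w; have [_ _ -> _] := selected1.
  exact/leq_ltn_trans/gain_add_above_le.
- by exists ws.
exists ws' => //; apply: greedy_below_pred below' => w walk_w.
have [_ _ pending' _] := selected'; rewrite /gain -pending'; apply: post' => //.
by rewrite mem_words; case/andP: walk_w.
Qed.

Lemma run_initialize :
  selected [::] (n.+1 * n.+1) (run initialize [::] (graph_store e)).
Proof.
have holds0 : holds (edge_set e) finset.set0 finset.set0 0 (graph_store e) by [].
have := run_init_threshold [::] (run_mark_diagonal [::] (run_mark_wedges [::] holds0)).
rewrite /selected uncovered_nil.
suff -> : [set p : 'I_n.+1 * 'I_n.+1 | p.2 \in flatten [::]] = finset.set0 by [].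
by apply/setP => p; rewrite !inE.
Qed.

Lemma run_greedy_cover k :
  exists2 ws, selected ws 0 (run (greedy_cover k) [::] (graph_store e)) &
    walks_below k 0 ws.
Proof.
set N := n.+1 * n.+1.
pose J m a := m <= N -> exists2 ws, selected ws (N - m) a &
  walks_below k (N - m) ws.
have sumN : 0 + \sum_(x < n.+1) \sum_(y < n.+1) 1 = N.
  by rewrite !sum_nat_const card_ord muln1.
have J0 : J 0 (run initialize [::] (graph_store e)).
  exists [::]; rewrite subn0; first exact: run_initialize.
  by apply: greedy_below_nil; rewrite (leq_trans (max_card _)) // card_prod card_ord.
suff : J (0 + \sum_(x < n.+1) \sum_(y < n.+1) 1)
    (run (Foreach (Foreach (Then (greedy_pass k) (Decr threshold)))) [::]
      (run initialize [::] (graph_store e))).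
  by rewrite sumN => /(_ (leqnn _)); rewrite subnn.
apply: (run_foreach_big (J := J)) J0 => x m a Ja.
apply: (run_foreach_big (J := J)) Ja => y m1 a1 Ja1; rewrite [_ m1 1]addn1 => lt_m1N.
have [ws selected1 below1] := Ja1 (ltnW lt_m1N).
have [|ws' [edges' chosen' pending' threshold'] below'] :=
  run_greedy_pass [:: y; x] _ selected1 below1; first by rewrite subn_gt0.
by exists ws'; rewrite subnS //; split; rewrite //= threshold'.
Qed.

End Runs.

Lemma size_flatten_uniform (T : Type) (m : nat) (ws : seq (seq T)) :
  all (fun w => size w == m) ws -> size (flatten ws) = m * size ws.
Proof.
by elim: ws => [|w ws IH] /=; rewrite ?muln0 // => /andP[/eqP size_w /IH];
  rewrite size_cat size_w mulnS => ->.
Qed.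

Lemma greedy_cover_correct n k (e : rel 'I_n.+1) : symmetric e ->
  feasible k.+1 e (output e (greedy_cover k)) /\
  exists2 c, #|output e (greedy_cover k)| <= k.+1 * c &
    forall (R : realType) m, coverable (reach e) (walk e k) (required e) m ->
      (c%:R <= m%:R * series harmonic #|required e| :> R)%R.
Proof.
move=> sym_e; set D := output _ _.
have [ws [_ chosen_ws _ _] below_ws] := run_greedy_cover e k.
have DE : D = [set x in flatten ws] by apply/setP => x; rewrite !inE chosen_ws inE.
have covered : uncovered (reach e) (required e) ws = finset.set0.
  by apply: greedy_below0_uncovered below_ws; exact: required_walk.
have [greedy_ws _] := below_ws; have walks := greedy_all greedy_ws.
split; first by rewrite DE; exact: covering_feasible.
exists (size ws) => [|R m cov].
  rewrite DE cardsE (leq_trans (card_size _)) // (size_flatten_uniform (m := k.+1)) //.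
  by apply: sub_all walks => w /andP[].
have := greedy_size R cov greedy_ws.
by rewrite covered cards0 /series /= big_geq // mulr0 addr0.
Qed.

(** * The approximation ratio *)

Section Ratio.

Variable R : realType.
Local Open Scope ring_scope.

Definition ratio_order (alpha n : nat) : R :=
  n%:R `^ (1 - alpha%:R^-1) * ln (n%:R) `^ (alpha%:R^-1).

Lemma ln2_ge_half : 2^-1 <= ln 2 :> R.
Proof.
have := series_harmonic_le_ln R (isT : 0 < 2)%N.
by rewrite !seriesSr /series /= big_geq //; lra.
Qed.

Lemma series_harmonic_le_4ln (n N : nat) : (1 < n)%N -> (N <= n * n)%N ->
  series harmonic N <= 4 * ln n%:R :> R.
Proof.
move=> n_gt1 le_N; have n_gt0 : (0 < n)%N by exact: ltnW.
have ln_ge : 2^-1 <= ln n%:R :> R.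
  by apply: le_trans ln2_ge_half _; rewrite ler_ln ?posrE ?ltr0n ?ler_nat.
have mono : series harmonic N <= series harmonic (n * n) :> R.
  by apply: (nondecreasing_series (P := xpredT)) => // *; exact: harmonic_ge0.
apply: le_trans mono _; apply: le_trans (series_harmonic_le_ln R _) _.
  by rewrite muln_gt0 n_gt0.
by rewrite natrM lnM ?posrE ?ltr0n //; lra.
Qed.

Lemma le_geometric_mean (d x y p : R) :
  0 <= p -> p <= 1 -> 0 <= d -> d <= x -> d <= y -> d <= x `^ (1 - p) * y `^ p.
Proof.
move=> p0 p1 d0 dx dy; have [->|d_neq0] := eqVneq d 0; first by rewrite mulr_ge0 ?powR_ge0.
have {1}-> : d = d `^ (1 - p) * d `^ p.
  by rewrite -powRD ?subrK ?powRr1 // d_neq0 implybT.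
by apply: ler_pM; rewrite ?powR_ge0 // ge0_ler_powR ?nnegrE ?subr_ge0 //;
  [exact: le_trans dx | exact: le_trans dy].
Qed.

Lemma le_ratio_order (alpha n d k : nat) (b : R) :
  (0 < alpha)%N -> (0 < n)%N -> 0 <= b -> (d <= n)%N ->
  d%:R <= b * ln n%:R * k%:R ^+ alpha ->
  d%:R <= b `^ (alpha%:R^-1) * ratio_order alpha n * k%:R.
Proof.
move=> alpha_gt0 n_gt0 b_ge0 le_dn le_d.
have ln_ge0' : 0 <= ln n%:R :> R by rewrite ln_ge0 // ler1n.
have root_k : (k%:R ^+ alpha) `^ (alpha%:R^-1) = k%:R :> R.
  by rewrite -powR_mulrn // -powRrM divff ?powRr1 // pnatr_eq0 -lt0n.
have -> : b `^ (alpha%:R^-1) * ratio_order alpha n * k%:R =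
    n%:R `^ (1 - alpha%:R^-1) * (b * ln n%:R * k%:R ^+ alpha) `^ (alpha%:R^-1).
  rewrite [in RHS]powRM ?mulr_ge0 ?exprn_ge0 // [in RHS]powRM // root_k.
  by rewrite /ratio_order; ring.
apply: le_geometric_mean => //; rewrite ?invr_ge0 ?ler_nat //.
by rewrite invf_le1 ?ltr0n // ler1n.
Qed.

End Ratio.

Lemma greedy_cover_ratio (R : realType) n k (e : rel 'I_n.+1) Dopt :
  symmetric e -> 0 < n -> feasible k.+1 e Dopt ->
  (#|output e (greedy_cover k)|%:R <=
   (4 * k.+1%:R) `^ (k.+1%:R^-1) * ratio_order R k.+1 n.+1 * #|Dopt|%:R)%R.
Proof.
move=> sym_e n_gt0 feas_opt.
have [_ [c D_c c_le]] := greedy_cover_correct k sym_e.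
apply: le_ratio_order => //.
  by rewrite -[leqRHS]card_ord max_card.
have req_le : #|required e| <= n.+1 * n.+1.
  by rewrite (leq_trans (max_card _)) // card_prod card_ord.
have := c_le R _ (feasible_coverable sym_e feas_opt).
have := series_harmonic_le_4ln R (n := n.+1) n_gt0 req_le.
set H := series _ _; set L := ln _ => H_le c_H.
apply: (@le_trans _ _ (k.+1 * c)%N%:R%R); first by rewrite ler_nat.
have -> : (4 * k.+1%:R * L * #|Dopt|%:R ^+ k.+1 =
           k.+1%:R * (#|Dopt|%:R ^+ k.+1 * (4 * L)))%R by ring.
rewrite natrM ler_wpM2l //; apply: le_trans c_H _.
by rewrite natrX ler_wpM2l ?exprn_ge0.
Qed.

Local Open Scope classical_set_scope.
Local Open Scope ring_scope.

Theorem theorem2 (R : realType) (alpha : nat) (halpha : (1 < alpha)%N) :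
  exists (r : nat -> R) (c : prog),
    (r =O_\oo (fun n : nat =>
       n%:R `^ (1 - alpha%:R^-1) * ln (n%:R) `^ (alpha%:R^-1))) /\
    polytime_approx alpha r c.
Proof.
case: alpha halpha => // k _.
pose b : R := (4 * k.+1%:R) `^ (k.+1%:R^-1).
exists (fun n => if (n <= 1)%N then 1 else b * ratio_order R k.+1 n).
exists (program (greedy_cover k)); split.
  apply/eqO_exP; exists b; first by rewrite powR_gt0 // mulr_gt0.
  near=> n; rewrite ifN; last by rewrite -ltnNge; near: n; exact: nbhs_infty_gt.
  by rewrite normrM (ger0_norm (powR_ge0 _ _)).
apply: program_approx => n e [sym_e _].
split=> [|Dopt [feas_opt _]]; first by have [] := greedy_cover_correct k sym_e.
case: leqP => [n_gt0|n_lt1]; first exact: greedy_cover_ratio.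
rewrite mul1r ler_nat (leq_trans (max_card _)) // card_ord (leq_trans n_lt1) //.
by rewrite (feasible_card_gt0 _ feas_opt) // card_ord.
Unshelve. all: by end_near.
Qed.
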